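(* Let $(\alpha_n(a,k,q),\beta_n(a,k,q))_{n\ge0}$ satisfy, for all parameters $a,k$, all bases $q$, and all $n\ge0$, \[ \beta_{n}(a,k,q) = \sum_{j=0}^{n}\frac{(k/a;q)_{n-j}(k;q)_{n+j}}{(q;q)_{n-j}(aq;q)_{n+j}}\alpha_{j}(a,k,q). \] Let $(g_n)$ be an arbitrary sequence and $e,c$ arbitrary constants. Define $\alpha_{2n}'(a,k,q) = g_n\alpha_n(e,c,q^2)$, $\alpha_{2n+1}'(a,k,q)=0$, and \[ \beta_{n}'(a,k,q)= \sum_{j=0}^{n}\beta_{j}(e,c,q^2)\frac{(1-c q^{4j})\left(\frac{k}{a};q\right)_{n-2j}(k;q)_{n+2j}(eq^2;q^2)_{2j}}{(1-c)(q;q)_{n-2j}(aq;q)_{n+2j}(cq^2;q^2)_{2j}} \sum_{r=0}^{\lfloor n/2 \rfloor-j}\frac{(1-eq^{4j+4r})(q^{-(n-2j)},kq^{n+2j};q)_{2r}(e/c,eq^{4j};q^2)_r\, g_{r+j}}{(1-e q^{4j})(a q^{n+2j+1},a q^{1-(n-2j)}/k;q)_{2r}(cq^{4j+2},q^2;q^2)_r}\left(\frac{q^2 c a^2}{k^2 e}\right)^r, \] where for $j>\lfloor n/2\rfloor$ the inner sum is empty and the corresponding term is $0$. Then $(\alpha_n'(a,k,q),\beta_n'(a,k,q))$ satisfies the same relation in base $q$.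
   Context: $(x;q)_n=\prod_{i=0}^{n-1}(1-xq^i)$, $(x_1,\dots,x_m;q)_n=\prod_i(x_i;q)_n$. Parameters are generic so denominators are nonzero. *)

(* Defs.v *)
From HB Require Import structures.
From mathcomp Require Import all_boot all_algebra.

Set Implicit Arguments.
Unset Strict Implicit.
Unset Printing Implicit Defensive.

Import GRing.Theory.
Local Open Scope ring_scope.

Definition qpoch (F : fieldType) (x q : F) (n : nat) : F :=
  \prod_(i < n) (1 - x * q ^+ i).

Definition qpochs (F : fieldType) (xs : seq F) (q : F) (n : nat) : F :=
  \prod_(x <- xs) qpoch x q n.

Definition wp_bailey_pair (F : fieldType) (alpha beta : nat -> F -> F -> F -> F)
    (a k q : F) : Prop :=
  forall n : nat,
    beta n a k q =
    \sum_(j < n.+1)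
      qpoch (k / a) q (n - j) * qpoch k q (n + j)
      / (qpoch q q (n - j) * qpoch (a * q) q (n + j)) * alpha j a k q.

(* The denominators a, (q;q)_m and (aq;q)_m of the relation are nonzero for
   all m; a base q is taken to be nonzero. *)
Definition wp_generic (F : fieldType) (a q : F) : Prop :=
  [/\ q != 0, a != 0,
      forall i : nat, q ^+ i.+1 != 1
    & forall i : nat, a * q ^+ i.+1 != 1].

(* The remaining denominators of [beta'] are nonzero for all n, together with
   (e q^2; q^2)_m, which occurs in the relation for (e, c, q^2). The condition
   k q^i != a says that (a q^{1-m} / k; q)_{2r} != 0 whenever 2r <= m. *)
Definition beta'_generic (F : fieldType) (e c a k q : F) : Prop :=
  [/\ k != 0, e != 0 & c != 0] /\
  [/\ forall i : nat, k * q ^+ i != a,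
      forall i : nat, e * q ^+ (2 * i) != 1
    & forall i : nat, c * q ^+ (2 * i) != 1].

Definition alpha' (F : fieldType) (alpha : nat -> F -> F -> F -> F)
    (g : nat -> F) (e c : F) (n : nat) (a k q : F) : F :=
  if odd n then 0 else g n./2 * alpha n./2 e c (q ^+ 2).

(* The terms with j > n/2 are zero by convention, hence the guard; under it,
   the natural-number subtractions below are not truncated. *)
Definition beta' (F : fieldType) (beta : nat -> F -> F -> F -> F)
    (g : nat -> F) (e c : F) (n : nat) (a k q : F) : F :=
  \sum_(j < n.+1 | (j <= n./2)%N)
    beta j e c (q ^+ 2)
    * ((1 - c * q ^+ (4 * j)) * qpoch (k / a) q (n - 2 * j)
       * qpoch k q (n + 2 * j) * qpoch (e * q ^+ 2) (q ^+ 2) (2 * j)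
       / ((1 - c) * qpoch q q (n - 2 * j) * qpoch (a * q) q (n + 2 * j)
          * qpoch (c * q ^+ 2) (q ^+ 2) (2 * j)))
    * \sum_(r < (n./2 - j).+1)
        (1 - e * q ^+ (4 * j + 4 * r))
        * qpochs [:: q ^- (n - 2 * j); k * q ^+ (n + 2 * j)] q (2 * r)
        * qpochs [:: e / c; e * q ^+ (4 * j)] (q ^+ 2) r
        * g (r + j)%N
        / ((1 - e * q ^+ (4 * j))
           * qpochs [:: a * q ^+ (n + 2 * j + 1);
                        a * (q * q ^- (n - 2 * j)) / k] q (2 * r)
           * qpochs [:: c * q ^+ (4 * j + 2); q ^+ 2] (q ^+ 2) r)
        * (q ^+ 2 * c * a ^+ 2 / (k ^+ 2 * e)) ^+ r.

(* Main.v *)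
(** Bailey's transform with the WP inversion: the matrix relating [alpha] to
    [beta] has an explicit inverse, because the orthogonality relation is a
    terminating very-well-poised 6phi5 sum with parameters A; B, C, D such that
    A = BCD, whose partial sums have a closed form. Inserting the inverse
    relation for (e, c, q^2) into the sum of the even-indexed terms, and
    interchanging the two summations, gives [beta'] term by term. *)
Require Import Defs.
From HB Require Import structures.
From mathcomp Require Import all_boot all_algebra.
From mathcomp Require Import ring zify.

Set Implicit Arguments.
Unset Strict Implicit.
Unset Printing Implicit Defensive.

Import GRing.Theory.
Local Open Scope ring_scope.

(** * Reindexing of finite sums *)

Lemma sum_triangle (V : nmodType) (n : nat) (f : nat -> nat -> V) :
  \sum_(j < n.+1) \sum_(i < j.+1) f j i =
  \sum_(i < n.+1) \sum_(t < (n - i).+1) f (i + t)%N i.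
Proof.
elim: n => [|n IHn]; first by rewrite !big_ord_recl !big_ord0.
rewrite big_ord_recr /= IHn [RHS]big_ord_recr /= subnn [in RHS]big_ord1 addn0.
rewrite [X in _ + X]big_ord_recr /= addrA; congr (_ + _).
rewrite -big_split /=; apply: eq_bigr => i _.
have le_in : (i <= n)%N by rewrite -ltnS.
by rewrite [in RHS]subSn // [RHS]big_ord_recr /= -subSn // subnKC // leqW.
Qed.

Lemma sum_even_indices (V : nmodType) (n : nat) (f : nat -> V) :
  \sum_(j < n.+1) (if odd j then 0 else f j) =
  \sum_(m < n./2.+1) f (2 * m)%N.
Proof.
elim: n => [|n IHn]; first by rewrite !big_ord1.
rewrite big_ord_recr /= IHn.
case: ifP => odd_n; first by rewrite addr0 uphalf_half; move: odd_n => /= /negbTE->.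
move/negbFE: odd_n => odd_n.
rewrite uphalf_half odd_n add1n [in RHS]big_ord_recr /=; congr (_ + f _).
by rewrite -[in LHS](odd_double_half n) odd_n mul2n doubleS.
Qed.

(** * Shifted factorials *)

Section QPochhammer.

Variables (F : fieldType) (q : F).

Lemma qpoch0 x : qpoch x q 0 = 1.
Proof. exact: big_ord0. Qed.

Lemma qpochSr x n : qpoch x q n.+1 = qpoch x q n * (1 - x * q ^+ n).
Proof. exact: big_ord_recr. Qed.

Lemma qpochD x m n :
  qpoch x q (m + n) = qpoch x q m * qpoch (x * q ^+ m) q n.
Proof.
elim: n => [|n IHn]; first by rewrite addn0 qpoch0 mulr1.
by rewrite addnS !qpochSr IHn -!mulrA -exprD.
Qed.

Lemma qpochSl x n : qpoch x q n.+1 = (1 - x) * qpoch (x * q) q n.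
Proof. by rewrite -add1n qpochD qpochSr qpoch0 mul1r expr0 mulr1 expr1. Qed.

Lemma qpoch_neq0 x n :
  (forall i, (i < n)%N -> x * q ^+ i != 1) -> qpoch x q n != 0.
Proof.
move=> x_neq; apply/prodf_neq0 => i _.
by rewrite subr_eq0 eq_sym x_neq.
Qed.

(** Each of the last s factors is rewritten by 1 - x q^m = -x q^m (1 - q^(-m)/x). The power of x is
    kept apart from a product free of x, so that this product cancels between two instances with
    different x. *)
Lemma qpoch_reverse x n s : x != 0 -> q != 0 -> (s <= n)%N ->
  qpoch x q n =
  qpoch x q (n - s) * qpoch (q * q ^- n / x) q s
  * (x ^+ s * \prod_(i < s) - q ^+ (n - i.+1)).
Proof.
move=> x0 q0; elim: s => [|s IHs] lt_sn.
  by rewrite subn0 qpoch0 big_ord0 !mulr1.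
rewrite IHs 1?ltnW // big_ord_recr /= (_ : n - s = (n - s.+1).+1)%N; last by lia.
rewrite !qpochSr exprSr.
have -> : q ^+ n = q ^+ (n - s.+1) * q ^+ s * q.
  by rewrite -exprD -exprSr; congr (_ ^+ _); lia.
by field; rewrite x0 q0 !expf_neq0.
Qed.

End QPochhammer.

(** * Inversion of the well-poised Bailey relation *)

Section WPInversion.

Variables (F : fieldType) (e c p : F).
Hypotheses (e_neq0 : e != 0) (c_neq0 : c != 0).
Hypothesis p_neq1 : forall i, p ^+ i.+1 != 1.
Hypothesis e_neq : forall i, e * p ^+ i != 1.
Hypothesis c_neq : forall i, c * p ^+ i != 1.

(** The coefficients of the Bailey relation at a = e, k = c, in base p. *)
Definition wp_mx (j i : nat) : F :=
  qpoch (c / e) p (j - i) * qpoch c p (j + i)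
  / (qpoch p p (j - i) * qpoch (e * p) p (j + i)).

(** Up to the very-well-poised factors and the power of c/e, this is [wp_mx] with e and c
    exchanged. *)
Definition wp_inv (n j : nat) : F :=
  (1 - e * p ^+ (2 * n)) / (1 - e) * ((1 - c * p ^+ (2 * j)) / (1 - c))
  * (qpoch (e / c) p (n - j) * qpoch e p (n + j)
     / (qpoch p p (n - j) * qpoch (c * p) p (n + j))) * (c / e) ^+ (n - j).

Let sub1_neq0 (x : F) : x != 1 -> 1 - x != 0.
Proof. by rewrite subr_eq0 eq_sym. Qed.

Let qp_neq0 n : qpoch p p n != 0.
Proof. by apply: qpoch_neq0 => i _; rewrite -exprS. Qed.

Let qe_neq0 n : qpoch (e * p) p n != 0.
Proof. by apply: qpoch_neq0 => i _; rewrite -mulrA -exprS. Qed.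

Let qc_neq0 n : qpoch (c * p) p n != 0.
Proof. by apply: qpoch_neq0 => i _; rewrite -mulrA -exprS. Qed.

(* The factor 1 - p ^+ (N - M) is not cancelled against qpoch p p (N - M), so
   that the formula also covers M = N, where the sum vanishes. *)
Lemma wp_partial_sum i N M : (0 < N)%N -> (M <= N)%N ->
  \sum_(t < M.+1) wp_inv (i + N) (i + t) * wp_mx (i + t) i =
  (1 - e * p ^+ (2 * (i + N))) / (1 - e) / (1 - c)
  * ((1 - p ^+ (N - M)) * qpoch (c / e * p) p M
     * qpoch e p (2 * i + N + M).+1 * qpoch c p (2 * i + M).+1
     * qpoch (e / c) p (N - M) * (c / e) ^+ (N - M))
  / ((1 - p ^+ N) * (1 - e * p ^+ (2 * i + N)) * qpoch p p M
     * qpoch (e * p) p (2 * i + M) * qpoch (c * p) p (2 * i + N + M)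
     * qpoch p p (N - M)).
Proof.
move=> N_gt0; have pN : 1 - p ^+ N != 0 by rewrite -(prednK N_gt0) sub1_neq0.
have e1 := sub1_neq0 (e_neq 0); have c1 := sub1_neq0 (c_neq 0).
rewrite !expr0 !mulr1 in e1 c1.
have eN := sub1_neq0 (e_neq (2 * i + N)).
elim: M => [|M IHM] le_MN.
  rewrite big_ord1 /wp_inv /wp_mx !addn0 subnn subn0 !qpoch0.
  rewrite addKn (_ : i + N + i = 2 * i + N)%N; last by lia.
  rewrite (_ : i + i = 2 * i)%N; last by lia.
  rewrite !qpochSr.
  by field; rewrite !qp_neq0 !qe_neq0 !qc_neq0 pN e1 c1 eN.
rewrite big_ord_recr /= IHM 1?ltnW // /wp_inv /wp_mx.
(* With N = K + M + 1, no truncated subtraction is left. *)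
have [K defN] : exists K, N = (K + M.+1)%N by exists (N - M.+1)%N; rewrite subnK.
rewrite (_ : i + N - (i + M.+1) = K)%N; last by lia.
rewrite (_ : i + M.+1 - i = M.+1)%N; last by lia.
rewrite (_ : N - M = K.+1)%N; last by lia.
rewrite (_ : N - M.+1 = K)%N; last by lia.
rewrite (_ : i + N + (i + M.+1) = (2 * i + N + M).+1)%N; last by lia.
rewrite (_ : i + M.+1 + i = (2 * i + M).+1)%N; last by lia.
rewrite !addnS.
(* [wp_mx] starts at c/e and the closed form at (c/e)p, so the first factor is split off here and
   the last one elsewhere. *)
rewrite [qpoch (c / e) p M.+1]qpochSl !qpochSr.
have := qp_neq0 K.+1; have := qp_neq0 M.+1.
have := qe_neq0 (2 * i + M).+1; have := qc_neq0 (2 * i + N + M).+1.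
rewrite !qpochSr !mulf_eq0 !negb_or.
move=> /andP[h1 h2] /andP[h3 h4] /andP[h5 h6] /andP[h7 h8].
move: h1 h2 h3 h4 h5 h6 h7 h8 pN eN.
(* With the common shifted factorials abstracted, the induction step is a rational identity in p^i,
   p^K, p^M and (c/e)^K. *)
repeat match goal with |- context [qpoch ?x ?b ?n] =>
  move: (qpoch x b n) => ? end.
rewrite defN !(mul2n, =^~ addnn) !(addSn, addnS) !(exprD, exprS).
move: (p ^+ i) (p ^+ K) (p ^+ M) ((c / e) ^+ K) => x y z w.
move=> h1 h2 h3 h4 h5 h6 h7 h8 pN eN.
by field; rewrite h1 h2 h3 h4 h5 h6 h7 h8 pN eN e1 c1 e_neq0.
Qed.

(** For N > 0 the partial sum at M = N contains 1 - p^0 = 0. For N = 0 the single diagonal product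
    is 1, by splitting (e;p) and (c;p) of length 2i+1 at either end. *)
Lemma wp_inv_mx i N :
  \sum_(t < N.+1) wp_inv (i + N) (i + t) * wp_mx (i + t) i = (N == 0)%:R.
Proof.
case: N => [|N]; last first.
  by rewrite wp_partial_sum // subnn expr0 subrr !(mul0r, mulr0).
have e1 := sub1_neq0 (e_neq 0); have c1 := sub1_neq0 (c_neq 0).
rewrite !expr0 !mulr1 in e1 c1.
have defe := qpochSl p e (2 * i); have defc := qpochSl p c (2 * i).
rewrite !qpochSr in defe defc.
rewrite big_ord1 /wp_inv /wp_mx !addn0 subnn !qpoch0 addnn -mul2n.
have := qe_neq0 (2 * i); have := qc_neq0 (2 * i).
move: defe defc; set E := qpoch (e * p) _ _; set C := qpoch (c * p) _ _.
move=> defe defc C0 E0.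
transitivity (((1 - e) * E) * ((1 - c) * C) / ((1 - e) * (1 - c) * C * E)).
  by rewrite -defe -defc; field; rewrite C0 E0 e1 c1.
by rewrite eqxx mulr1n; field; rewrite C0 E0 e1 c1.
Qed.

(** After the sums are interchanged, orthogonality kills the coefficient of [al i] unless i = n. *)
Lemma wp_inversion (al be : nat -> F) :
  (forall j, be j = \sum_(i < j.+1) wp_mx j i * al i) ->
  forall n, al n = \sum_(j < n.+1) wp_inv n j * be j.
Proof.
move=> def_be n.
under eq_bigr do rewrite def_be mulr_sumr.
rewrite (sum_triangle n (fun j i => wp_inv n j * (wp_mx j i * al i))).
rewrite big_ord_recr /= subnn big1 ?add0r => [|i _]; last first.
  under eq_bigr do rewrite mulrA.
  rewrite -mulr_suml -[in wp_inv n](subnKC (ltnW (ltn_ord i))) wp_inv_mx.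
  by rewrite subn_eq0 leqNgt ltn_ord mul0r.
under eq_bigr do rewrite mulrA.
rewrite -mulr_suml; have := wp_inv_mx n 0; rewrite addn0 => ->.
by rewrite mul1r.
Qed.

End WPInversion.

(** * Identification of the summands and conclusion *)

(** Reversing the last 2r factors of (k/a;q)_N and (q;q)_N, where N = n - 2j, produces the bases a
    q^(1-N)/k and q^(-N). The leftover (k/(aq))^(2r) turns the r-th power in [beta'] into (c/e)^r,
    as in [wp_inv]. *)
Lemma beta'_term (F : fieldType) (e c a k q : F) (n j r : nat) :
  wp_generic a q -> beta'_generic e c a k q -> (2 * (j + r) <= n)%N ->
  (1 - c * q ^+ (4 * j)) * qpoch (k / a) q (n - 2 * j)
    * qpoch k q (n + 2 * j) * qpoch (e * q ^+ 2) (q ^+ 2) (2 * j)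
    / ((1 - c) * qpoch q q (n - 2 * j) * qpoch (a * q) q (n + 2 * j)
       * qpoch (c * q ^+ 2) (q ^+ 2) (2 * j))
  * ((1 - e * q ^+ (4 * j + 4 * r))
     * qpochs [:: q ^- (n - 2 * j); k * q ^+ (n + 2 * j)] q (2 * r)
     * qpochs [:: e / c; e * q ^+ (4 * j)] (q ^+ 2) r
     / ((1 - e * q ^+ (4 * j))
        * qpochs [:: a * q ^+ (n + 2 * j + 1);
                     a * (q * q ^- (n - 2 * j)) / k] q (2 * r)
        * qpochs [:: c * q ^+ (4 * j + 2); q ^+ 2] (q ^+ 2) r)
     * (q ^+ 2 * c * a ^+ 2 / (k ^+ 2 * e)) ^+ r) =
  qpoch (k / a) q (n - 2 * (j + r)) * qpoch k q (n + 2 * (j + r))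
  / (qpoch q q (n - 2 * (j + r)) * qpoch (a * q) q (n + 2 * (j + r)))
  * wp_inv e c (q ^+ 2) (j + r) j.
Proof.
move=> [q0 a0 qn an] [[k0 e0 c0] [kn en cn]] le_jrn.
have q4 i : (q ^+ 2) ^+ (2 * i) = q ^+ (4 * i) by rewrite -exprM mulnA.
have en4 : 1 - e * q ^+ (4 * j) != 0.
  by rewrite subr_eq0 eq_sym; have := en (2 * j)%N; rewrite mulnA.
have c1 : 1 - c != 0 by rewrite subr_eq0 eq_sym; have := cn 0%N; rewrite mulr1.
have e1 : 1 - e != 0 by rewrite subr_eq0 eq_sym; have := en 0%N; rewrite mulr1.
have qq0 m : qpoch q q m != 0 by apply: qpoch_neq0 => i _; rewrite -exprS.
have aq0 m : qpoch (a * q) q m != 0.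
  by apply: qpoch_neq0 => i _; rewrite -mulrA -exprS.
have pp0 m : qpoch (q ^+ 2) (q ^+ 2) m != 0.
  by apply: qpoch_neq0 => i _; rewrite -exprS -exprM; apply: qn.
have cp0 m : qpoch (c * q ^+ 2) (q ^+ 2) m != 0.
  by apply: qpoch_neq0 => i _; rewrite -mulrA -exprS -exprM; apply: cn.
rewrite /wp_inv !q4 addKn (_ : j + r + j = 2 * j + r)%N; last by lia.
set N := (n - 2 * j)%N; have le_rN : (2 * r <= N)%N by rewrite /N; lia.
rewrite (_ : n - 2 * (j + r) = N - 2 * r)%N; last by rewrite /N; lia.
rewrite (_ : n + 2 * (j + r) = n + 2 * j + 2 * r)%N; last by lia.
have ka0 : k / a != 0 by rewrite mulf_neq0 ?invr_neq0.
(* A vanishing factor with index i would give k q^(N-i-1) = a. *)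
have kq0 : qpoch (a * (q * q ^- N) / k) q (2 * r) != 0.
  apply: qpoch_neq0 => i lt_ir; apply: contra (kn (N - i.+1)%N) => /eqP eq1.
  have qN : q ^+ N = q * q ^+ i * q ^+ (N - i.+1).
    by rewrite -exprS -exprD subnKC // (leq_trans lt_ir).
  apply/eqP; rewrite -[LHS]mulr1 -eq1 qN.
  by field; rewrite k0 q0 !expf_neq0.
have := qpoch_reverse ka0 q0 le_rN; have := qpoch_reverse q0 q0 le_rN.
have -> : q * q ^- N / (k / a) = a * (q * q ^- N) / k.
  by field; rewrite k0 a0 expf_neq0.
have -> : q * q ^- N / q = q ^- N by field; rewrite q0 expf_neq0.
set P := \prod_(i < _) _ => def_q def_k.
(* Since (q;q)_N is nonzero, so are all its factors after reversal, including P and the shifted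
   factorial of q^(-N). *)
have := qq0 N; rewrite def_q !mulf_eq0 !negb_or.
move=> /andP[/andP[h1 h2] /andP[h3 h4]].
have defe := qpochSl (q ^+ 2) e (2 * j); rewrite qpochSr q4 in defe.
have := aq0 (n + 2 * j + 2 * r)%N; have := cp0 (2 * j + r)%N.
have := aq0 (n + 2 * j)%N; have := cp0 (2 * j)%N; have := pp0 r.
rewrite def_k /qpochs !big_cons !big_nil.
move: (n + 2 * j)%N kq0 => D kq0.
rewrite !(qpochD _ _ D) !(qpochD _ _ (2 * j)) !q4.
rewrite (_ : c * q ^+ (4 * j + 2) = c * q ^+ 2 * q ^+ (4 * j)); last first.
  by rewrite -mulrA -exprD addnC.
rewrite (_ : a * q ^+ (D + 1) = a * q * q ^+ D); last by rewrite -mulrA -exprS addn1.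
rewrite mulnDr.
set X := qpoch e (q ^+ 2) (2 * j) in defe *.
set E := qpoch (e * q ^+ 2) _ _ in defe *.
(* [wp_inv] starts from e and [beta'] from e q^2; this trades the first factor for the last. *)
have -> : X = (1 - e) * E / (1 - e * q ^+ (4 * j)) by rewrite -defe mulfK.
have -> : (q ^+ 2 * c * a ^+ 2 / (k ^+ 2 * e)) ^+ r
    = q ^+ (2 * r) * c ^+ r * (a ^+ r) ^+ 2 / ((k ^+ r) ^+ 2 * e ^+ r).
  by rewrite exprM !(exprMn, exprVn).
have -> : (k / a) ^+ (2 * r) = (k ^+ r / a ^+ r) ^+ 2.
  by rewrite mulnC exprM exprMn exprVn.
rewrite [(c / e) ^+ r]exprMn exprVn.
have := expf_neq0 r k0; have := expf_neq0 r a0; have := expf_neq0 r e0.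
move: kq0 h1 h2 h3 h4 en4.
move: (q ^+ (2 * r)) (k ^+ r) (a ^+ r) (e ^+ r) (c ^+ r) => xq xk xa xe xc.
move: (q ^+ (4 * j)) (q ^+ (4 * j + 4 * r)) => y z.
repeat match goal with |- context [qpoch ?x ?b ?n] =>
  move: (qpoch x b n) => ? end.
clear - c1 e1.
move=> g1 g2 g3 g4 g5 g6 g7 g8 g9 g10 g11.
rewrite !mulf_eq0 !negb_or => g12 /andP[_ g13] /andP[_ g14].
by field; rewrite c1 e1 g1 g2 g3 g4 g5 g6 g7 g8 g9 g10 g11 g12 g13 g14.
Qed.

Theorem theorem3p7 (F : fieldType) (alpha beta : nat -> F -> F -> F -> F)
    (Hpair : forall a k q : F, wp_generic a q -> wp_bailey_pair alpha beta a k q)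
    (g : nat -> F) (e c a k q : F)
    (Haq : wp_generic a q) (Hgen : beta'_generic e c a k q) :
  wp_bailey_pair (alpha' alpha g e c) (beta' beta g e c) a k q.
Proof.
move=> n; have [q0 a0 qn an] := Haq; have [[k0 e0 c0] [kn en cn]] := Hgen.
have p_neq1 i : (q ^+ 2) ^+ i.+1 != 1 by rewrite -exprM; apply: qn.
have e_neq i : e * (q ^+ 2) ^+ i != 1 by rewrite -exprM; apply: en.
have c_neq i : c * (q ^+ 2) ^+ i != 1 by rewrite -exprM; apply: cn.
have gen_ep : wp_generic e (q ^+ 2) by split=> //; rewrite expf_neq0.
have alphaE := wp_inversion e0 c0 p_neq1 e_neq c_neq
  (al := fun i => alpha i e c (q ^+ 2)) (fun j => Hpair e c (q ^+ 2) gen_ep j).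
pose A j := qpoch (k / a) q (n - j) * qpoch k q (n + j)
  / (qpoch q q (n - j) * qpoch (a * q) q (n + j)).
transitivity (\sum_(j < n.+1)
    if odd j then 0 else A j * (g j./2 * alpha j./2 e c (q ^+ 2))); last first.
  by apply: eq_bigr => j _; rewrite /alpha'; case: ifP; rewrite // mulr0.
pose f j := A j * (g j./2 * alpha j./2 e c (q ^+ 2)).
rewrite (sum_even_indices n f) {}/f.
(* Only indices 2m contribute, and there alpha_m(e,c,q^2) is expanded in the beta_j(e,c,q^2). *)
under [RHS]eq_bigr do rewrite mul2n doubleK -mul2n alphaE !mulr_sumr.
pose G m j := A (2 * m)%N * (g m * (wp_inv e c (q ^+ 2) m j * beta j e c (q ^+ 2))).
(* The interchange sets m = j + r, with r the inner index of [beta']. *)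
rewrite [RHS](sum_triangle n./2 G) /beta'.
(* Widening the range of j to n recovers the guard in [beta']. *)
have le_h : (n./2.+1 <= n.+1)%N by lia.
rewrite (big_ord_widen _
  (fun j => \sum_(t < (n./2 - j).+1) G (j + t)%N j) le_h).
apply: eq_bigr => j le_j; rewrite mulr_sumr; apply: eq_bigr => r _.
have le_jrn : (2 * (j + r) <= n)%N by have := ltn_ord r; lia.
rewrite /G /A (mulrCA (g _)) [RHS]mulrA -(beta'_term Haq Hgen le_jrn).
rewrite [(r + j)%N]addnC.
by ring.
Qed.
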